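(* For $x \in \mathbb{Z}$ let $A_x = \left[ (i-x, j-x) \right]_{0 \leq i, j \leq \ell-1}$. For all integers $0 \leq u, v \leq \ell-1$, $$A_u A_v = k \left(\delta_{u,\, v+\frac{q-1}{2}}\, I_{\ell} - E_{u+\frac{q-1}{2},\, v}\right) + \sum_{w=0}^{\ell-1} (u-v, w-v)\, A_w,$$ where $I_\ell$ is the $\ell\times\ell$ identity matrix, $\delta_{s,t}=1$ if $s \equiv t \pmod{\ell}$ and $\delta_{s,t}=0$ otherwise, and $E_{s,t}$ is the $\ell\times\ell$ matrix whose only nonzero entry is a $1$ in position $(s,t)$ (indices taken modulo $\ell$).
   Context: Let $q$ be a power of an odd prime, $\ell$ a positive divisor of $q-1$, $k = \frac{q-1}{\ell}$, $g$ a fixed generator of $\mathbb{F}_q^{*}$, and $K$ the subgroup of $\mathbb{F}_q^*$ consisting of all $\ell$-th powers of nonzero elements, so $|K|=k$. For integers $i,j$ the cyclotomic number $(i,j)$ is $(i,j) = \left| (1 + g^i K) \cap g^j K \right|$; it depends only on $i,j$ modulo $\ell$. Rows and columns of $\ell\times\ell$ matrices are indexed by $0,1,\ldots,\ell-1$, and indices are read modulo $\ell$. *)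

(* Defs.v *)
From HB Require Import structures.
From mathcomp Require Import all_boot all_order all_algebra all_fingroup all_solvable all_field.

Set Implicit Arguments.
Unset Strict Implicit.
Unset Printing Implicit Defensive.

Import GRing.Theory Num.Theory.
Local Open Scope ring_scope.

Definition powers_subgroup (F : finFieldType) (l : nat) : {set F} :=
  [set x ^+ l | x in [set y : F | y != 0]].

Definition cyclotomic_class (F : finFieldType) (l : nat) (g : F) (i : int) :
    {set F} :=
  [set g ^ i * x | x in powers_subgroup F l].

Definition cyclotomic_number (F : finFieldType) (l : nat) (g : F) (i j : int) :
    nat :=
  #|[set 1 + x | x in cyclotomic_class l g i] :&: cyclotomic_class l g j|.

Definition cyclotomic_mx (F : finFieldType) (l : nat) (g : F) (x : int) :
    'M[int]_l :=
  \matrix_(i < l, j < l)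
    (cyclotomic_number l g (i%:Z - x) (j%:Z - x))%:Z.

Definition delta_mod (l : nat) (s t : int) : int :=
  (s == t %[mod l])%Z%:R.

(* Unlike [delta_mx], the position is given by integers read modulo l. *)
Definition E_mx (l : nat) (s t : int) : 'M[int]_l :=
  \matrix_(i < l, j < l) ((i%:Z == s %[mod l])%Z && (j%:Z == t %[mod l])%Z)%:R.

(* Main.v *)
(* Write C_i = g^i K, so that -1 lies in C_h. Scaling by g^v and by g^w shows
   that, at position (i, j), both the product and the sum over w count triples
   (a, x, z) in C_u * C_i * C_j with a + x + g^v = z: the product sorts them by
   the class of a + x and misses those with a + x = 0, the sum sorts them by
   the class of a + g^v and misses those with a + g^v = 0. The two families of
   missed triples account for the E and the delta term respectively. *)
Require Import Defs.
From HB Require Import structures.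
From mathcomp Require Import all_boot all_order all_algebra all_fingroup all_solvable all_field.
From mathcomp Require Import ring.

Import GRing.Theory Num.Theory.
Local Open Scope ring_scope.

Lemma generator_unit_prim_root (F : finFieldType) (g : {unit F}) :
  generator [set: {unit F}] g -> (#|F|.-1).-primitive_root (val g).
Proof.
move=> /eqP g_gen.
have og : #[g]%g = #|F|.-1 by rewrite -card_finField_unit g_gen.
have g_exp1 n : (val g ^+ n == 1) = (#|F|.-1 %| n)%N.
  by rewrite -og order_dvdn -(inj_eq val_inj) FinRing.val_unitX FinRing.val_unit1.
have q1_gt0 : (0 < #|F|.-1)%N by rewrite -og order_gt0.
have /eqP gq1 : val g ^+ #|F|.-1 == 1 by rewrite g_exp1.
(* Here [m] is the exact order of [val g] in the field and divides [#|F|.-1]; conversely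
   [val g ^+ m = 1] and [g_exp1] give the other divisibility. *)
have [m m_prim m_dvd] := prim_order_exists q1_gt0 gq1.
suff <- : m = #|F|.-1 by [].
by apply/eqP; rewrite eqn_dvd m_dvd -g_exp1 prim_expr_order ?eqxx.
Qed.

Section CyclotomicClasses.

Set Implicit Arguments.
Unset Strict Implicit.

Variables (F : finFieldType) (l : nat) (g : F).
Hypothesis g_prim : (#|F|.-1).-primitive_root g.
Hypothesis l_dvd : (l %| #|F|.-1)%N.

Local Notation C := (cyclotomic_class l g).
Local Notation cyc := (cyclotomic_number l g).
Local Notation ind i x := ((x \in C i)%:R : int).

(** * Membership in classes through discrete logarithms *)

Lemma prim_root_neq0 : g != 0.
Proof. by rewrite (prim_root_eq0 g_prim) -lt0n; case/andP: g_prim. Qed.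

Lemma index_gt0 : (0 < l)%N.
Proof. by apply: dvdn_gt0 l_dvd; case/andP: g_prim. Qed.

Lemma discrete_log (x : F) : x != 0 -> exists n : nat, x = g ^+ n.
Proof.
move=> x_neq0; have /(prim_rootP g_prim)[n ->] : x ^+ #|F|.-1 = 1; last by exists n.
apply: (mulfI x_neq0); rewrite -exprS mulr1 prednK ?expf_card //.
by apply/card_gt0P; exists 0.
Qed.

Lemma prim_root_expz_eq1 (a : int) : (g ^ a == 1) = (#|F|.-1 %| `|a|)%N.
Proof.
by case: a => n; rewrite ?NegzE -?invr_expz ?invr_eq1 ?abszN -exprnP absz_nat
  (prim_order_dvd g_prim).
Qed.

Lemma cyclotomic_class_neq0 (i : int) (x : F) : x \in C i -> x != 0.
Proof.
case/imsetP=> y /imsetP[z]; rewrite inE => z_neq0 -> ->.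
by rewrite mulf_neq0 ?expf_neq0 ?expfz_neq0 ?prim_root_neq0.
Qed.

Lemma mem0_cyclotomic_class (i : int) : (0 \in C i) = false.
Proof. by apply: contraTF isT => /cyclotomic_class_neq0; rewrite eqxx. Qed.

(** Turns membership into a congruence of exponents. Exponents of [g] matter only modulo [#|F|.-1],
    and [l] divides that number, so their residue modulo [l] is well defined. *)
Lemma mem_cyclotomic_class_expz (a i : int) :
  (g ^ a \in C i) = (a == i %[mod l])%Z.
Proof.
have g_neq0 := prim_root_neq0.
rewrite eqz_mod_dvd; apply/idP/idP.
  case/imsetP=> y /imsetP[z]; rewrite inE => /discrete_log[n ->] -> ga.
  have : g ^ (a - i - (n * l)%N%:Z) == 1.
    rewrite !expfzDr // ga exprnP exprnP exprz_exp -PoszM -!invr_expz.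
    by rewrite [g ^ i * _]mulrC mulfK ?mulfV ?expfz_neq0.
  rewrite prim_root_expz_eq1 => /(dvdn_trans l_dvd).
  rewrite -[(l %| _)%N]/(l%:Z %| _)%Z => l_dvd_ain.
  rewrite -[X in (_ %| X)%Z](subrK (n * l)%N%:Z) rpredD //.
  by rewrite PoszM dvdz_mull.
case/dvdzP=> t a_eq; apply/imsetP; exists ((g ^ t) ^+ l).
  by apply/imsetP; exists (g ^ t); rewrite ?inE ?expfz_neq0.
by rewrite exprnP exprz_exp -a_eq -expfzDr // addrC subrK.
Qed.

Lemma mem_cyclotomic_classM (w i : int) (c x : F) :
  c \in C w -> (c * x \in C i) = (x \in C (i - w)).
Proof.
move=> cw; have /discrete_log[n def_c] := cyclotomic_class_neq0 cw.
have [->|/discrete_log[m ->]] := eqVneq x 0.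
  by rewrite mulr0 !mem0_cyclotomic_class.
move: cw; rewrite def_c -exprD !exprnP !mem_cyclotomic_class_expz.
rewrite !eqz_mod_dvd => l_dvd_nw.
have -> : (n + m)%N%:Z - i = (n%:Z - w) + (m%:Z - (i - w)).
  by rewrite PoszD; ring.
by rewrite (rpredDl _ l_dvd_nw).
Qed.

Lemma mem_cyclotomic_classV (w i : int) (c x : F) :
  c \in C w -> (c / x \in C i) = (x \in C (w - i)).
Proof.
move=> cw; have [->|] := eqVneq x 0.
  by rewrite invr0 mulr0 !mem0_cyclotomic_class.
move=> /discrete_log[m ->]; rewrite (mem_cyclotomic_classM _ _ cw).
rewrite exprnP invr_expz !mem_cyclotomic_class_expz !eqz_mod_dvd.
have -> : - m%:Z - (i - w) = - (m%:Z - (w - i)) by ring.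
by rewrite rpredN.
Qed.

Lemma eqz_mod_cyclotomic_class (i j : int) (x : F) :
  (i == j %[mod l])%Z -> (x \in C i) = (x \in C j).
Proof.
move=> ij; have [->|] := eqVneq x 0; first by rewrite !mem0_cyclotomic_class.
by move=> /discrete_log[m ->]; rewrite exprnP !mem_cyclotomic_class_expz (eqP ij).
Qed.

(** Used from right to left: the condition [y != 0] is what remains after summing over the class
    that contains [y]. *)
Lemma cyclotomic_class_partition (y : F) : \sum_(m < l) ind m y = (y != 0)%:R.
Proof.
have [->|] := eqVneq y 0.
  by rewrite big1 // => m _; rewrite mem0_cyclotomic_class.
move=> /discrete_log[n ->]; rewrite exprnP.
have l_gt0 := index_gt0.
rewrite (bigD1 (Ordinal (ltn_pmod n l_gt0))) //= big1 => [|m m_neq].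
  by rewrite addr0 mem_cyclotomic_class_expz -modz_nat modz_mod eqxx.
rewrite mem_cyclotomic_class_expz; case: eqP => //= /eqP.
rewrite !modz_nat eqz_nat (modn_small (ltn_ord m)) => /eqP n_m.
by case/eqP: m_neq; apply: val_inj.
Qed.

(** Multiplication by [g ^ (i - j)] carries class j onto class i, so the [l] classes, which
    partition the nonzero elements, have equal size. *)
Lemma sum_ind_cyclotomic_class (i : int) :
  \sum_x ind i x = (#|F|.-1 %/ l)%N%:Z.
Proof.
have l_neq0 : (l%:Z != 0) by rewrite eqz_nat -lt0n index_gt0.
have shift j : \sum_x ind i x = \sum_x ind j x.
  rewrite (reindex_inj (mulfI (expfz_neq0 (i - j) prim_root_neq0))).
  apply: eq_bigr => x _; rewrite (mem_cyclotomic_classM (w := i - j)).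
    by rewrite opprB addrC subrK.
  by rewrite mem_cyclotomic_class_expz.
apply: (mulfI l_neq0); rewrite -PoszM mulnC divnK //.
have -> : l%:Z * \sum_x ind i x = \sum_(m < l) \sum_x ind m x.
  rewrite -(eq_bigr _ (fun (m : 'I_l) _ => shift m)) sumr_const card_ord.
  by rewrite -mulr_natl natz.
rewrite exchange_big /= (eq_bigr _ (fun x _ => cyclotomic_class_partition x)).
rewrite (bigD1 0) //= eqxx add0r (eq_bigr (fun=> 1)) => [|x ->] //.
by rewrite sumr_const cardC1 natz.
Qed.

(** * Cyclotomic numbers as sums of indicators *)

Lemma cyclotomic_numberE (i j : int) :
  (cyc i j)%:Z = \sum_x ind i x * ind j (1 + x).
Proof.
rewrite /cyclotomic_number -(_ : [set 1 + x | x in [set x in C i | 1 + x \in C j]]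
  = [set 1 + x | x in C i] :&: C j).
  rewrite card_imset; last exact: addrI.
  rewrite -natz -sum1_card natr_sum big_mkcond /=; apply: eq_bigr => x _.
  by rewrite inE; case: (x \in C i); case: (1 + x \in C j).
apply/setP => y; rewrite in_setI; apply/imsetP/andP.
  case=> x; rewrite inE => /andP[xi xj] ->; split=> //.
  by apply/imsetP; exists x.
by case=> /imsetP[x xi ->] xj; exists x; rewrite // inE xi.
Qed.

(** Scaling by [b] replaces the 1 in the definition by any chosen element of class [w]. *)
Lemma cyclotomic_number_shift (i j w : int) (b : F) : b \in C w ->
  (cyc (i - w) (j - w))%:Z = \sum_x ind i x * ind j (x + b).
Proof.
move=> bw; rewrite cyclotomic_numberE.
rewrite [RHS](reindex_inj (mulfI (cyclotomic_class_neq0 bw))).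
apply: eq_bigr => x _; rewrite -[X in _ * x + X]mulr1 -mulrDr [x + 1]addrC.
by rewrite !(mem_cyclotomic_classM _ _ bw).
Qed.

(* Substituting [a = y / (1 + x)]; the junk value [1 / 0 = 0] makes this a bijection of F. *)
Lemma cyclotomic_number_complement (i m u : int) (y : F) : y \in C m ->
  (cyc (i - u) (m - u))%:Z = \sum_a ind u a * ind i (y - a).
Proof.
move=> ym; rewrite cyclotomic_numberE.
have inj : injective (fun x => y / (1 + x)).
  move=> x1 x2 /(mulfI (cyclotomic_class_neq0 ym)) /invr_inj.
  exact: addrI.
rewrite [RHS](reindex_inj inj); apply: eq_bigr => x _.
rewrite mulrC (mem_cyclotomic_classV _ _ ym).
(* Both sides vanish outside this class. Inside it 1 + x is nonzero, so a = y / (1 + x) is a true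
   quotient, it lies in [C u], and y - a = a x. *)
have [x1|] := boolP (1 + x \in C (m - u)); last by rewrite !mul0r.
have x1_neq0 := cyclotomic_class_neq0 x1.
have -> : y - y / (1 + x) = y / (1 + x) * x.
  by rewrite -{1}(divfK x1_neq0 y) mulrDr mulr1 addrC addKr.
rewrite (mem_cyclotomic_classM (w := u)) //.
by rewrite (mem_cyclotomic_classV _ _ ym).
Qed.

(** The second factor is scaled by [g ^ v], which makes y its summation variable; once y is in
    [C m], the first factor counts the splittings of y as a + (y - a). *)
Lemma sum_cyclotomic_number_mul_left (i j u v : int) :
  \sum_(m < l) (cyc (i - u) (m%:Z - u))%:Z * (cyc (m%:Z - v) (j - v))%:Z =
  \sum_y (y != 0)%:R * (ind j (y + g ^ v) * \sum_a ind u a * ind i (y - a)).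
Proof.
have gv : g ^ v \in C v by rewrite mem_cyclotomic_class_expz.
under eq_bigr => m _ do rewrite (cyclotomic_number_shift _ _ gv) mulr_sumr.
rewrite exchange_big; apply: eq_bigr => y _ /=.
rewrite -cyclotomic_class_partition mulr_suml; apply: eq_bigr => m _.
have [ym|] := boolP (y \in C m); last by rewrite !mul0r mulr0.
by rewrite (cyclotomic_number_complement _ _ ym) !mul1r mulrC.
Qed.

(** The first factor is scaled by [g ^ v], the second by a + g^v, whose class is exactly the one
    that [w] selects. *)
Lemma sum_cyclotomic_number_mul_right (i j u v : int) :
  \sum_(w < l) (cyc (u - v) (w%:Z - v))%:Z * (cyc (i - w%:Z) (j - w%:Z))%:Z =
  \sum_a (a + g ^ v != 0)%:R *
    (ind u a * \sum_x ind i x * ind j (x + (a + g ^ v))).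
Proof.
have gv : g ^ v \in C v by rewrite mem_cyclotomic_class_expz.
under eq_bigr => w _ do rewrite (cyclotomic_number_shift _ _ gv) mulr_suml.
rewrite exchange_big; apply: eq_bigr => a _ /=.
rewrite -cyclotomic_class_partition mulr_suml; apply: eq_bigr => w _.
have [aw|] := boolP (a + g ^ v \in C w); last by rewrite mulr0 !mul0r.
by rewrite (cyclotomic_number_shift _ _ aw) mulr1 mul1r.
Qed.

Lemma sum_neq0_mul (G : F -> int) (c : F) :
  \sum_x (x + c != 0)%:R * G x = \sum_x G x - G (- c).
Proof.
rewrite [X in _ = X - _](bigD1 (- c)) //= [X in _ = X - _]addrC addrK.
rewrite [LHS](bigD1 (- c)) //= addNr eqxx mul0r add0r.
apply: eq_bigr => x; rewrite -addr_eq0 => ->.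
by rewrite mul1r.
Qed.

Lemma sum_ind_mul (i j : int) :
  \sum_x ind i x * ind j x = (i == j %[mod l])%Z%:R * (#|F|.-1 %/ l)%N%:Z.
Proof.
have [ij|ij] := boolP (i == j %[mod l])%Z.
  rewrite mul1r -(sum_ind_cyclotomic_class i); apply: eq_bigr => x _.
  by rewrite -(eqz_mod_cyclotomic_class x ij); case: (x \in C i).
rewrite mul0r big1 // => x _; have [->|] := eqVneq x 0.
  by rewrite !mem0_cyclotomic_class.
move=> /discrete_log[n ->]; rewrite exprnP !mem_cyclotomic_class_expz.
case: eqP => [->|]; last by rewrite mul0r.
by rewrite (negPf ij) mulr0.
Qed.

Lemma cyclotomic_number_convolution (h i j u v : int) : -1 = g ^ h ->
  \sum_(m < l) (cyc (i - u) (m%:Z - u))%:Z * (cyc (m%:Z - v) (j - v))%:Z =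
  (#|F|.-1 %/ l)%N%:Z * ((u == v + h %[mod l])%Z%:R * (i == j %[mod l])%Z%:R
     - ((i == u + h %[mod l])%Z && (j == v %[mod l])%Z)%:R)
  + \sum_(w < l) (cyc (u - v) (w%:Z - v))%:Z * (cyc (i - w%:Z) (j - w%:Z))%:Z.
Proof.
move=> def_h; rewrite sum_cyclotomic_number_mul_left sum_cyclotomic_number_mul_right.
have hN x s : (- x \in C s) = (x \in C (s - h)).
  by rewrite -mulN1r (mem_cyclotomic_classM (w := h)) // def_h mem_cyclotomic_class_expz.
(* With y written as y + 0, [sum_neq0_mul] completes both sums, at the excluded points y = 0 and a =
   -g^v. *)
under eq_bigr => y _ do rewrite -[y in y != 0]addr0.
rewrite !sum_neq0_mul oppr0 add0r.
(* The completed sums agree: exchange the summations and put y = x + a. *)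
have -> : \sum_y ind j (y + g ^ v) * (\sum_a ind u a * ind i (y - a)) =
   \sum_a ind u a * (\sum_x ind i x * ind j (x + (a + g ^ v))).
  under eq_bigr => y _ do rewrite mulr_sumr.
  rewrite exchange_big; apply: eq_bigr => a _ /=; rewrite mulr_sumr.
  rewrite (reindex_inj (addIr a)); apply: eq_bigr => x _.
  by rewrite addrK addrA mulrCA [ind j _ * _]mulrC.
(* Only the two added terms remain. Each is a class condition times the size of an intersection of
   two classes: [C u] with [C (i - h)] on the left, [C i] with [C j] on the right. *)
under [in X in _ - X = _]eq_bigr => a _ do rewrite sub0r hN.
rewrite sum_ind_mul hN !mem_cyclotomic_class_expz addNr.
have -> : \sum_x ind i x * ind j (x + 0) = \sum_x ind i x * ind j x.
  by apply: eq_bigr => x _; rewrite addr0.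
rewrite sum_ind_mul -(eqz_modDr h u (i - h)) -(eqz_modDr h v (u - h)) !subrK.
rewrite [(v + h == u %[mod l])%Z]eq_sym [(u + h == i %[mod l])%Z]eq_sym.
rewrite [(v == j %[mod l])%Z]eq_sym -mulnb natrM.
ring.
Qed.

End CyclotomicClasses.

Theorem lemma1 (p e q l k : nat) (F : finFieldType) (g : {unit F})
  (p_prime : prime p) (p_odd : odd p) (e_gt0 : (0 < e)%N)
  (q_def : q = (p ^ e)%N) (cardF : #|F| = q)
  (l_gt0 : (0 < l)%N) (l_dvd : (l %| q - 1)%N) (k_def : k = ((q - 1) %/ l)%N)
  (g_gen : generator [set: {unit F}] g) (u v : 'I_l) :
  let h : int := ((q - 1) %/ 2)%N%:Z in
  let A := cyclotomic_mx l (val g) in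
  A u *m A v =
    k%:Z *: ((delta_mod l u (v%:Z + h))%:M - E_mx l (u%:Z + h) v)
    + \sum_(w < l)
        (cyclotomic_number l (val g) (u%:Z - v%:Z) (w%:Z - v%:Z))%:Z *: A w.
Proof.
move=> h A.
have g_prim := generator_unit_prim_root _ _ g_gen.
have q1E : (q - 1)%N = #|F|.-1 by rewrite cardF subn1.
rewrite q1E in l_dvd k_def.
have q1_even : ((q - 1) %/ 2 * 2 = q - 1)%N.
  by rewrite divnK // dvdn2 oddB ?q_def ?expn_gt0 ?prime_gt0 // oddX p_odd orbT.
have q1_gt0 : (0 < q - 1)%N by rewrite q1E; case/andP: g_prim.
have half_lt : ((q - 1) %/ 2 < q - 1)%N by rewrite ltn_Pdiv.
have half_gt0 : (0 < (q - 1) %/ 2)%N.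
  by rewrite lt0n; apply: contraTneq q1_gt0 => half0; rewrite -q1_even half0.
(* The power is a square root of 1, since twice [h] is q - 1, and it is not 1, since 0 < h < q -
   1. *)
have def_h : -1 = val g ^ h.
  have : val g ^+ ((q - 1) %/ 2) ^+ 2 == 1.
    by rewrite -exprM q1_even q1E prim_expr_order.
  rewrite sqrf_eq1 -(prim_order_dvd g_prim) -q1E.
  by rewrite gtnNdvd //= => /eqP <-.
apply/matrixP => i j; rewrite !mxE summxE.
under eq_bigr => m _ do rewrite !mxE.
under [in RHS]eq_bigr => w _ do rewrite !mxE.
rewrite (cyclotomic_number_convolution g_prim l_dvd _ _ _ _ def_h) k_def.
congr (_ * (_ - _) + _).
(* Both indices lie below [l], so their congruence is equality and gives the identity matrix. *)
rewrite /delta_mod (_ : (i == j %[mod l])%Z = (i == j)) ?mulr_natr //.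
by rewrite !modz_nat eqz_nat !modn_small ?ltn_ord.
Qed.
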